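(* Let $\tilde K=\sum_{i=1}^\infty a_iK_i$ where each $K_i$ is a Markov kernel reversible with respect to a probability distribution $\pi$, $a_i\ge0$, $\sum_i a_i=1$. Suppose $a_1>0$ and $K_1$ has $\pi$ as its unique invariant distribution. Then if $K_1$ is variance bounding, so is $\tilde K$; and if $K_1$ is geometrically ergodic, so is $\tilde K$.
   Context: For a kernel $P$ reversible w.r.t. $\pi$, $\sigma_0(P)$ denotes its spectrum as a self-adjoint operator on $L^2_0(\pi)$ (mean-zero square-integrable functions). $P$ is variance bounding if $\sup\sigma_0(P)<1$ and geometrically ergodic if $\sup|\sigma_0(P)|<1$. *)

(* Defs.v *)
From HB Require Import structures.
From mathcomp Require Import all_boot all_order all_algebra.
From mathcomp Require Import all_classical all_reals all_analysis.
Set Implicit Arguments. Unset Strict Implicit. Unset Printing Implicit Defensive.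
Import Order.TTheory GRing.Theory Num.Theory.
Local Open Scope classical_set_scope.
Local Open Scope ring_scope.

Section Defs.
Context {d : measure_display} {T : measurableType d} {R : realType}.

Definition kreversible (K : R.-pker T ~> T) (pi : probability T R) : Prop :=
  forall A B : set T, measurable A -> measurable B ->
    (\int[pi]_(x in A) K x B = \int[pi]_(x in B) K x A)%E.

Definition invariant_distr (K : R.-pker T ~> T) (mu : probability T R) : Prop :=
  forall A : set T, measurable A -> (\int[mu]_x K x A)%E = mu A.

Definition L2sq (pi : probability T R) (f : T -> R) : \bar R :=
  (\int[pi]_x ((f x) ^+ 2)%:E)%E.

Definition inL20 (pi : probability T R) (f : T -> R) : Prop :=
  measurable_fun setT f /\ (L2sq pi f < +oo)%E /\ (\int[pi]_x (f x)%:E = 0)%E.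

Definition kact (K : R.-pker T ~> T) (f : T -> R) : T -> R :=
  fun x => fine (\int[K x]_y (f y)%:E)%E.

(* lam lies in the resolvent set of K acting on L^2_0(pi):
   K - lam I is a bijection of L^2_0(pi) onto itself with bounded inverse
   (bounded below + onto; elements of L^2 are identified up to pi-a.e. equality) *)
Definition resolvent0 (K : R.-pker T ~> T) (pi : probability T R) (lam : R) : Prop :=
  (exists C : R, forall f, inL20 pi f ->
     (L2sq pi f <= C%:E * L2sq pi (fun x => (kact K f x - lam * f x)%R))%E) /\
  (forall g, inL20 pi g -> exists f, inL20 pi f /\
     {ae pi, forall x, kact K f x - lam * f x = g x}).

(* sigma_0(K): spectrum of K as a (self-adjoint) operator on L^2_0(pi);
   for a self-adjoint operator the spectrum is real *)
Definition spectrum0 (K : R.-pker T ~> T) (pi : probability T R) : set R :=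
  [set lam | ~ resolvent0 K pi lam].

Definition variance_bounding (K : R.-pker T ~> T) (pi : probability T R) : Prop :=
  (ereal_sup [set lam%:E | lam in spectrum0 K pi] < 1)%E.

Definition geometrically_ergodic (K : R.-pker T ~> T) (pi : probability T R) : Prop :=
  (ereal_sup [set (`|lam|)%:E | lam in spectrum0 K pi] < 1)%E.

End Defs.

(* Main.v *)
Require Import Defs.
From HB Require Import structures.
From mathcomp Require Import all_boot all_order all_algebra.
From mathcomp Require Import all_classical all_reals all_analysis.
From mathcomp Require Import finmap measurable_realfun ring lra.
Import Order.TTheory GRing.Theory Num.Theory.
Import numFieldNormedType.Exports.
Local Open Scope classical_set_scope.
Local Open Scope ring_scope.
Set Implicit Arguments.
Unset Strict Implicit.
Unset Printing Implicit Defensive.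

(* For [e = 1] and [e = -1], [<f, f> - e <K f, f>] is half the integral of [(f
   x - e f y)^2] against [pi(dx) K(x, dy)], so [a_0 K_0 <= Kt] transports a
   gap [e <K_0 f, f> <= M <f, f>], [M < 1], from [K_0] to [Kt]. It remains to
   relate such gaps to the spectrum. The supremum of the numerical range of a
   symmetric contraction [A] lies in its spectrum, by Cauchy-Schwarz for the
   form [<(M - A) f, g>]. Conversely, if [l - A] is coercive then it is
   bounded below, and it is onto by Richardson iteration and the completeness
   of [L^2]. *)

(** Kernels act on actual functions, by [fine] of an integral that may fail to be finite on a
    [pi]-null set even for [f] in [L^2(pi)]. So [K] is additive only almost everywhere. The abstract
    part therefore assumes symmetry and contractivity of the operator instead of linearity, and
    equations are solved up to vectors [x] with [q x x = 0]. The sign [e] serves the two ends of the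
    spectrum: [e = 1] bounds it from above, [e = -1] from below; variance bounding is the first case
    and geometric ergodicity the conjunction. If [e <K_0 f, f> <= M <f, f>], energy domination gives
    [<f, f> - e <Kt f, f> >= a_0 (1 - M) <f, f>], so [e * l <= 1 - a_0 (1 - M)] for [l] in the
    spectrum of [Kt]. *)

Lemma eq0_of_sqr_le_geometric (R : realType) (u C r : R) :
  0 <= r -> r < 1 -> (forall n, u ^+ 2 <= C * r ^+ n) -> u = 0.
Proof.
move=> r0 r1 uC; apply/eqP; rewrite -sqrf_eq0 eq_le sqr_ge0 andbT.
have cr : (C * r ^+ n) @[n --> \oo] --> (0 : R).
  by rewrite -(mulr0 C); apply: cvgMr; apply: cvg_expr; rewrite ger0_norm.
rewrite -(cvg_lim (@Rhausdorff R) cr); apply: limr_ge; last exact: nearW.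
by apply/cvg_ex; eexists; exact: cr.
Qed.

(** * Positive semidefinite forms on a linear domain *)

Section semi_inner_product.
Context {R : realType} {V : lmodType R}.

(* Only semidefinite: functions equal a.e. need not be identified. *)
Record semi_inner (D : V -> Prop) (q : V -> V -> R) : Prop := SemiInner {
  semi_dom0 : D 0;
  semi_dom : forall a x y, D x -> D y -> D (a *: x + y);
  semi_linear : forall a x y z, D x -> D y -> D z ->
    q (a *: x + y) z = a * q x z + q y z;
  semi_sym : forall x y, D x -> D y -> q x y = q y x;
  semi_ge0 : forall x, D x -> 0 <= q x x }.

Context {D : V -> Prop} {q : V -> V -> R} (Dq : semi_inner D q).

Lemma semi_domD x y : D x -> D y -> D (x + y).
Proof. by move=> Dx Dy; rewrite -[x]scale1r; exact: (semi_dom Dq). Qed.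

Lemma semi_domZ a x : D x -> D (a *: x).
Proof.
move=> Dx; rewrite -[_ *: x]addr0.
by apply: (semi_dom Dq) => //; exact: (semi_dom0 Dq).
Qed.

Lemma semi_domB x y : D x -> D y -> D (x - y).
Proof.
by move=> Dx Dy; rewrite -scaleN1r; exact/semi_domD/semi_domZ.
Qed.

Lemma semi_dom_sum (h : nat -> V) n : (forall i, D (h i)) -> D (\sum_(i < n) h i).
Proof.
move=> Dh; elim: n => [|n IHn]; first by rewrite big_ord0; exact: (semi_dom0 Dq).
by rewrite big_ord_recr /=; exact: (semi_domD IHn).
Qed.

Lemma semiDl x y z : D x -> D y -> D z -> q (x + y) z = q x z + q y z.
Proof. by move=> Dx Dy Dz; rewrite -{1}[x]scale1r (semi_linear Dq)// mul1r. Qed.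

Lemma semi0l z : D z -> q 0 z = 0.
Proof.
move=> Dz; have D0 := semi_dom0 Dq; have := semiDl D0 D0 Dz.
by rewrite addr0 => /esym/eqP; rewrite -[eqbRHS]addr0 (inj_eq (addrI _)) => /eqP.
Qed.

Lemma semiZl a x z : D x -> D z -> q (a *: x) z = a * q x z.
Proof.
move=> Dx Dz; rewrite -[_ *: x]addr0 (semi_linear Dq)//; first by rewrite semi0l// addr0.
exact: (semi_dom0 Dq).
Qed.

Lemma semiBl x y z : D x -> D y -> D z -> q (x - y) z = q x z - q y z.
Proof.
move=> Dx Dy Dz; rewrite -scaleN1r semiDl ?semiZl ?mulN1r//.
exact: semi_domZ.
Qed.

Lemma semi_suml (h : nat -> V) n z : (forall i, D (h i)) -> D z ->
  q (\sum_(i < n) h i) z = \sum_(i < n) q (h i) z.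
Proof.
move=> Dh Dz; elim: n => [|n IHn]; first by rewrite !big_ord0 semi0l.
by rewrite !big_ord_recr /= semiDl ?IHn//; exact: semi_dom_sum.
Qed.

Lemma semi_sqrB a x y : D x -> D y ->
  q (x - a *: y) (x - a *: y) = q x x - 2 * a * q x y + a ^+ 2 * q y y.
Proof.
move=> Dx Dy; have Day := semi_domZ a Dy; have Dxy := semi_domB Dx Day.
rewrite semiBl// ![q _ (x - _)](semi_sym Dq)// !semiBl// !semiZl//.
rewrite [q x (a *: y)](semi_sym Dq)// [q y (a *: y)](semi_sym Dq)// !semiZl//.
by rewrite (semi_sym Dq Dx Dy); ring.
Qed.

Lemma semi_cauchy_schwarz x y : D x -> D y -> q x y ^+ 2 <= q x x * q y y.
Proof.
move=> Dx Dy.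
have P a : 0 <= q x x - 2 * a * q x y + a ^+ 2 * q y y.
  by rewrite -semi_sqrB//; apply: (semi_ge0 Dq) => //; apply/semi_domB/semi_domZ.
have := semi_ge0 Dq Dy; rewrite le_eqVlt => /predU1P[y0|y0].
  have [->|xy0] := eqVneq (q x y) 0; first by rewrite -y0 expr0n mulr0.
  (* When [q y y = 0] the quadratic is affine in [a], and at this [a] it equals -1. *)
  have := P ((q x x + 1) / (2 * q x y)); rewrite -y0 mulr0 addr0.
  rewrite (_ : 2 * _ * _ = q x x + 1); last by field.
  by lra.
(* The minimizer of the quadratic. *)
have := P (q x y / q y y).
rewrite (_ : _ - _ + _ = (q x x * q y y - q x y ^+ 2) / q y y); last first.
  by field; rewrite gt_eqF.
by rewrite pmulr_lge0 ?invr_gt0// subr_ge0.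
Qed.

End semi_inner_product.

(** * Symmetric contractions: numerical range and solvability *)

Section symmetric_contraction.
Context {R : realType} {V : lmodType R} {D : V -> Prop} {q : V -> V -> R}.
Hypothesis Dq : semi_inner D q.
Variable A : V -> V.
Hypothesis DA : forall x, D x -> D (A x).
Hypothesis A_sym : forall x y, D x -> D y -> q (A x) y = q x (A y).
Hypothesis A_contr : forall x, D x -> q (A x) (A x) <= q x x.

Lemma contraction_range x : D x -> `|q (A x) x| <= q x x.
Proof.
move=> Dx; rewrite -ler_sqr ?nnegrE ?normr_ge0 ?(semi_ge0 Dq)//.
rewrite real_normK ?num_real// (le_trans (semi_cauchy_schwarz Dq (DA Dx) Dx))//.
by rewrite expr2 ler_wpM2r ?A_contr ?(semi_ge0 Dq).
Qed.

Definition shiftop (l : R) (x : V) : V := l *: x - A x.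

Lemma shiftop_dom l x : D x -> D (shiftop l x).
Proof. by move=> Dx; apply: (semi_domB Dq); [exact: (semi_domZ Dq)|exact: DA]. Qed.

Lemma shiftopE l x y : D x -> D y -> q (shiftop l x) y = l * q x y - q (A x) y.
Proof.
by move=> Dx Dy; rewrite (semiBl Dq) ?(semiZl Dq)//; [exact: (semi_domZ Dq)|exact: DA].
Qed.

Lemma shiftop_sym l x y : D x -> D y -> q (shiftop l x) y = q x (shiftop l y).
Proof.
move=> Dx Dy; have Dly := shiftop_dom l Dy.
rewrite [RHS](semi_sym Dq)// !shiftopE// A_sym// (semi_sym Dq Dx Dy).
by rewrite (semi_sym Dq Dx)//; exact: DA.
Qed.

(** Linearity of the operator, seen only through [q]: symmetry moves [shiftop l] to [z], and the
    form is linear in its first argument. *)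
Lemma shiftop_linear l a x y z : D x -> D y -> D z ->
  q (shiftop l (a *: x + y)) z = a * q (shiftop l x) z + q (shiftop l y) z.
Proof.
move=> Dx Dy Dz; rewrite shiftop_sym//; last exact: (semi_dom Dq).
by rewrite (semi_linear Dq)// ?shiftop_sym//; exact: shiftop_dom.
Qed.

Lemma shiftop_le l x : D x -> q (shiftop l x) x <= (`|l| + 1) * q x x.
Proof.
move=> Dx; rewrite shiftopE// mulrDl mul1r lerD//.
  by rewrite ler_wpM2r ?(semi_ge0 Dq)// ler_norm.
by rewrite (le_trans _ (contraction_range Dx))// -normrN ler_norm.
Qed.

(* Cauchy-Schwarz for the form [q (shiftop l x) y] at [x] and [shiftop l x]. *)
Lemma shiftop_sqr_le l x : (forall x, D x -> 0 <= q (shiftop l x) x) -> D x ->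
  q (shiftop l x) (shiftop l x) <= (`|l| + 1) * q (shiftop l x) x.
Proof.
move=> pos Dx; have Dlx := shiftop_dom l Dx.
have SI : semi_inner D (fun x y => q (shiftop l x) y).
  split; first exact: (semi_dom0 Dq).
  - exact: (semi_dom Dq).
  - by move=> *; exact: shiftop_linear.
  - by move=> y z Dy Dz; rewrite shiftop_sym// (semi_sym Dq)//; exact: shiftop_dom.
  - exact: pos.
have := semi_cauchy_schwarz SI Dx Dlx.
have := semi_ge0 Dq Dlx; rewrite le_eqVlt => /predU1P[<- _|Q0].
  by rewrite mulr_ge0 ?pos// addr_ge0.
rewrite expr2 => H; rewrite -(ler_pM2r Q0) (le_trans H)//.
rewrite [leRHS]mulrAC [leRHS]mulrC; apply: ler_wpM2l; first exact: pos.
exact: shiftop_le.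
Qed.

Definition bounded_below (l : R) : Prop :=
  exists C : R, forall x, D x -> q x x <= C * q (shiftop l x) (shiftop l x).

(** For a positive operator a lower bound on the norm upgrades to coercivity, since [shiftop_sqr_le]
    bounds the squared norm by the form itself. The constant uses [|C| + 1] because [C] may be
    nonpositive. *)
Lemma bounded_below_gap l : (forall x, D x -> 0 <= q (shiftop l x) x) ->
  bounded_below l ->
  exists2 e : R, 0 < e & forall x, D x -> e * q x x <= q (shiftop l x) x.
Proof.
move=> pos [C hC]; have E0 : 0 < (`|C| + 1) * (`|l| + 1).
  by rewrite mulr_gt0// ltr_wpDl.
exists ((`|C| + 1) * (`|l| + 1))^-1; first by rewrite invr_gt0.
move=> x Dx; rewrite mulrC ler_pdivrMr// (le_trans (hC _ Dx))//.
rewrite [leRHS]mulrC -mulrA.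
have Q0 := semi_ge0 Dq (shiftop_dom l Dx).
apply: (@le_trans _ _ ((`|C| + 1) * q (shiftop l x) (shiftop l x))).
  by rewrite ler_wpM2r// ler_wpDr// ler_norm.
by apply: ler_wpM2l; [rewrite addr_ge0|exact: shiftop_sqr_le].
Qed.

(* The supremum of the numerical range is not in the resolvent set: otherwise
   [bounded_below_gap] would improve the bound. *)
Lemma range_lt1 : (forall l, ~ bounded_below l -> l < 1) ->
  exists2 M : R, M < 1 & forall x, D x -> q (A x) x <= M * q x x.
Proof.
move=> spec; pose E := [set r | exists2 x, D x & 0 < q x x /\ r = q (A x) x / q x x].
have q0A x : D x -> q x x = 0 -> q (A x) x = 0.
  by move=> Dx x0; have := contraction_range Dx; rewrite x0 normr_le0 => /eqP.
(* No Rayleigh quotient exists exactly when [q x x] vanishes on the whole domain; then any [M < 1]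
   serves. *)
have [/eqP E0|/set0P E0] := boolP (E == set0).
  exists 0 => // x Dx; rewrite mul0r.
  have := semi_ge0 Dq Dx; rewrite le_eqVlt => /predU1P[x0|x0].
    by rewrite q0A.
  by exfalso; rewrite -[False]/(set0 (q (A x) x / q x x)) -E0; exists x.
have supE : has_sup E.
  split=> //; exists 1 => _ [x Dx [x0 ->]]; rewrite ler_pdivrMr// mul1r.
  by rewrite (le_trans _ (contraction_range Dx))// ler_norm.
have ubE x : D x -> q (A x) x <= sup E * q x x.
  move=> Dx; have := semi_ge0 Dq Dx; rewrite le_eqVlt => /predU1P[x0|x0].
    by rewrite q0A// -x0 mulr0.
  by rewrite -ler_pdivrMr//; apply: sup_upper_bound => //; exists x.
exists (sup E) => //; apply: spec => bb.
have [|e e0 gap] := @bounded_below_gap (sup E) _ bb.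
  by move=> x Dx; rewrite shiftopE// subr_ge0 ubE.
(* A Rayleigh quotient above [sup E - e] contradicts the gap [e]. *)
have [_ [x Dx [x0 ->]]] := sup_adherent e0 supE.
rewrite ltr_pdivlMr// mulrBl; have := gap _ Dx; rewrite shiftopE//.
by lra.
Qed.

(** Expand [0 <= q (B x - c x) (B x - c x)] with [B = shiftop l]: the cross term is at least
    [2 c^2 q x x], which leaves [c^2 q x x <= q (B x) (B x)]. *)
Lemma coercive_bounded_below l c x : 0 < c ->
  (forall x, D x -> c * q x x <= q (shiftop l x) x) -> D x ->
  q x x <= (c ^+ 2)^-1 * q (shiftop l x) (shiftop l x).
Proof.
move=> c0 coer Dx; have Dlx := shiftop_dom l Dx.
rewrite mulrC ler_pdivlMr ?exprn_gt0//.
have := semi_ge0 Dq (semi_domB Dq Dlx (semi_domZ Dq c Dx)).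
rewrite (semi_sqrB Dq)//; have := ler_wpM2l (ltW c0) (coer _ Dx).
by lra.
Qed.

(** Completeness for series with geometrically decaying terms, as produced by the iteration. The
    remainders may decay at another rate [r']: for [L^2] it is the square root of [r]. *)
Hypothesis complete : forall (h : nat -> V) (r C : R),
  (forall n, D (h n)) -> 0 < r -> r < 1 ->
  (forall n, q (h n) (h n) <= C * r ^+ n) ->
  exists2 f, D f & exists C' r' : R, [/\ 0 <= r', r' < 1 &
    forall n, q (f - \sum_(i < n) h i) (f - \sum_(i < n) h i) <= C' * r' ^+ n].

(* Richardson iteration: the increments [h n = (1 - t shiftop l)^n (t g)]
   decay geometrically and sum to the solution. *)
Lemma coercive_onto (l c : R) g : 0 < c ->
  (forall x, D x -> c * q x x <= q (shiftop l x) x) -> D g ->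
  exists2 f, D f & q (shiftop l f - g) (shiftop l f - g) = 0.
Proof.
move=> c0 coer Dg.
(* The first summand bounds the squared norm of [shiftop l]; the second makes [c^2 < L], so that [r]
   below is positive. *)
pose L : R := (`|l| + 1) ^+ 2 + c ^+ 2 * 2.
have c2 : 0 < c ^+ 2 by rewrite exprn_gt0.
have L0 : 0 < L by rewrite /L; have := sqr_ge0 (`|l| + 1); lra.
have pos x : D x -> 0 <= q (shiftop l x) x.
  by move=> Dx; rewrite (le_trans _ (coer _ Dx))// mulr_ge0 ?(ltW c0) ?(semi_ge0 Dq).
have Bbound x : D x -> q (shiftop l x) (shiftop l x) <= L * q x x.
  move=> Dx; have Q0 := semi_ge0 Dq Dx.
  rewrite (le_trans (shiftop_sqr_le pos Dx))//.
  apply: (@le_trans _ _ ((`|l| + 1) * ((`|l| + 1) * q x x))).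
    by apply: ler_wpM2l; [rewrite addr_ge0|exact: shiftop_le].
  by rewrite mulrA -expr2 ler_wpM2r// /L lerDl mulr_ge0// ltW.
(* One step multiplies [q x x] by at most [1 - 2 t c + t^2 L], which is minimal at [t = c / L], with
   value [r]. *)
pose t : R := c / L; have t0 : 0 < t by rewrite divr_gt0.
pose r : R := 1 - c ^+ 2 / L.
have r0 : 0 < r.
  by rewrite subr_gt0 ltr_pdivrMr// mul1r /L; have := sqr_ge0 (`|l| + 1); lra.
have r1 : r < 1 by rewrite /r ltrBlDr ltrDl divr_gt0.
pose next x := x - t *: shiftop l x.
have Dnext x : D x -> D (next x).
  by move=> Dx; apply: (semi_domB Dq) => //; apply/(semi_domZ Dq)/shiftop_dom.
have nextr x : D x -> q (next x) (next x) <= r * q x x.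
  move=> Dx; have Dlx := shiftop_dom l Dx.
  rewrite /next (semi_sqrB Dq)// (semi_sym Dq Dx)//.
  have H1 := ler_wpM2l (ltW t0) (coer _ Dx).
  have H2 := ler_wpM2l (sqr_ge0 t) (Bbound _ Dx).
  have e1 : t ^+ 2 * L = c ^+ 2 / L by rewrite /t; field; rewrite gt_eqF.
  have e2 : t * c = c ^+ 2 / L by rewrite /t; field; rewrite gt_eqF.
  rewrite mulrA e2 in H1; rewrite mulrA e1 in H2; rewrite /r mulrBl mul1r.
  by move: H1 H2; lra.
pose h n := iter n next (t *: g).
have Dh n : D (h n).
  by elim: n => [|n IHn]; [exact: (semi_domZ Dq)|exact: Dnext].
pose C := q (h 0%N) (h 0%N).
have hr n : q (h n) (h n) <= C * r ^+ n.
  elim: n => [|n IHn]; first by rewrite expr0 mulr1.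
  rewrite (le_trans (nextr _ (Dh n)))// exprS mulrCA.
  by rewrite ler_wpM2l// ltW.
have [f Df [C' [r' [r'0 r'1 fC]]]] := complete Dh r0 r1 hr.
exists f => //.
have Dlf := shiftop_dom l Df; have DR := semi_domB Dq Dlf Dg.
set k := shiftop l f - g in DR *.
have Dlk := shiftop_dom l DR.
have Ds n := semi_dom_sum Dq n Dh.
(* Since [t * shiftop l (h i)] is [h i - h i.+1], the sum telescopes. It is tested against [k]
   because [shiftop l] distributes over sums only inside [q]. *)
have partial n : q (\sum_(i < n) h i) (shiftop l k) = q g k - t^-1 * q (h n) k.
  rewrite (semi_suml Dq)//; elim: n => [|n IHn].
    by rewrite big_ord0 /= (semiZl Dq)//; field; rewrite gt_eqF.
  rewrite big_ord_recr IHn /= -/(h n) /next (semiBl Dq)//; last first.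
    by apply/(semi_domZ Dq)/shiftop_dom/Dh.
  rewrite (semiZl Dq)//; last exact/shiftop_dom/Dh.
  by rewrite -(shiftop_sym _ (Dh n))//; field; rewrite gt_eqF.
have kE n : q k k = q (f - \sum_(i < n) h i) (shiftop l k) - t^-1 * q (h n) k.
  rewrite {1}/k (semiBl Dq)// (semiBl Dq)// partial shiftop_sym//; ring.
pose s := Num.max r r'.
have s0 : 0 <= s by rewrite le_max (ltW r0).
have s1 : s < 1 by rewrite gt_max r1.
have C0 : 0 <= C by exact: (semi_ge0 Dq).
have C'0 : 0 <= C'.
  by have := fC 0%N; rewrite expr0 mulr1 big_ord0 subr0; exact/le_trans/(semi_ge0 Dq).
(* By [kE] the norm of the residual is a difference [u - t^-1 * v] for every [n]. Both terms decay
   by Cauchy-Schwarz, and the factors 2 come from [(u - w)^2 <= 2 u^2 + 2 w^2]. *)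
apply: (@eq0_of_sqr_le_geometric _ _
  (2 * C' * q (shiftop l k) (shiftop l k) + 2 * t ^- 2 * C * q k k) s) => // n.
have Dfn := semi_domB Dq Df (Ds n).
have H1 : q (f - \sum_(i < n) h i) (shiftop l k) ^+ 2 <=
    C' * q (shiftop l k) (shiftop l k) * s ^+ n.
  rewrite (le_trans (semi_cauchy_schwarz Dq Dfn Dlk))// mulrAC.
  rewrite ler_wpM2r ?(semi_ge0 Dq)// (le_trans (fC n))//.
  by rewrite ler_wpM2l// lerXn2r ?nnegrE// le_max lexx orbT.
have H2 : q (h n) k ^+ 2 <= C * q k k * s ^+ n.
  rewrite (le_trans (semi_cauchy_schwarz Dq (Dh n) DR))// mulrAC.
  rewrite ler_wpM2r ?(semi_ge0 Dq)// (le_trans (hr n))//.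
  by rewrite ler_wpM2l// lerXn2r ?nnegrE// ?(ltW r0)// le_max lexx.
rewrite [in leLHS](kE n) -exprVn.
have H3 := ler_wpM2l (sqr_ge0 t^-1) H2.
move: H1 H3; set u := q (f - _) _; set v := q (h n) k => H1 H3.
have := sqr_ge0 (u + t^-1 * v).
by move: H1 H3; lra.
Qed.

End symmetric_contraction.

(** * Induction on nonnegative measurable functions *)

Section nneg_induction.
Local Open Scope ereal_scope.
Context {d : measure_display} {T : measurableType d} {R : realType}.
Implicit Types f g : T -> \bar R.

Import HBNNSimple.

(** Simple functions are finite nonnegative combinations of indicators, and increase to any
    nonnegative measurable function. The combination step receives measurability and nonnegativity
    so that integrals can be split there. *)
Lemma nneg_measurable_ind (P : (T -> \bar R) -> Prop) :
  (forall A, measurable A -> P (fun x => (\1_A x)%:E)) ->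
  (forall (k : R) f g, (0 <= k)%R ->
    measurable_fun setT f -> (forall x, 0 <= f x) -> P f ->
    measurable_fun setT g -> (forall x, 0 <= g x) -> P g ->
    P (fun x => k%:E * f x + g x)) ->
  (forall (f_ : nat -> T -> \bar R) f,
    (forall n, measurable_fun setT (f_ n)) -> (forall n x, 0 <= f_ n x) ->
    (forall x, {homo f_^~ x : n m / (n <= m)%N >-> n <= m}) ->
    (forall x, f_ n x @[n --> \oo] --> f x) ->
    (forall n, P (f_ n)) -> P f) ->
  forall f, measurable_fun setT f -> (forall x, 0 <= f x) -> P f.
Proof.
move=> Pindic Plin Plim f mf f0.
have Psum (h : T -> R) (s : seq R) : measurable_fun setT h ->
    all (fun r : R => 0 <= r)%R s ->
    P (fun x => (\sum_(r <- s) r * \1_(h @^-1` [set r]) x)%:E).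
  move=> mh; elim: s => [_|r s IHs /= /andP[r0 s0]].
    (* The empty sum is the indicator of the empty set. *)
    have := Pindic _ measurable0; congr P; apply/funext => x.
    by rewrite big_nil indic0.
  have mi t : measurable (h @^-1` [set t]).
    by rewrite -[_ @^-1` _]setTI; exact: mh.
  have mI t : measurable_fun setT (fun x => (t * \1_(h @^-1` [set t]) x)%R).
    by apply: measurable_funM => //; exact: measurable_indic.
  rewrite [X in P X](_ : _ = fun x => r%:E * (\1_(h @^-1` [set r]) x)%:E +
      (\sum_(r <- s) r * \1_(h @^-1` [set r]) x)%:E); last first.
    by apply/funext => x; rewrite big_cons EFinD EFinM.
  apply: (Plin r (fun x => (\1_(h @^-1` [set r]) x)%:E)) => //.
  - exact/measurable_EFinP/measurable_indic.
  - exact/Pindic/mi.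
  - by apply/measurable_EFinP/measurable_sum => t; exact: mI.
  - move=> x; rewrite lee_fin; elim: s s0 {IHs} => [|t s IHs /= /andP[t0 s0]].
      by rewrite big_nil.
    by rewrite big_cons addr_ge0// ?mulr_ge0//; exact: IHs.
  - exact: IHs.
apply: (Plim (fun n x => (nnsfun_approx measurableT mf n x)%:E)).
- by move=> n; exact/measurable_EFinP.
- by move=> n x; rewrite lee_fin.
- by move=> x a b ab; rewrite lee_fin; exact/lefP/nd_nnsfun_approx.
- by move=> x; exact: cvg_nnsfun_approx.
- move=> n; set h := nnsfun_approx _ _ n.
  rewrite [X in P X](_ : _ = fun x =>
    (\sum_(r <- fset_set (range h)) r * \1_(h @^-1` [set r]) x)%:E).
    apply: Psum => //; apply/allP => r.
    by rewrite in_fset_set//= => /set_mem[x _ <-].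
  by apply/funext => x; rewrite {1}fimfunE fsbig_finite.
Qed.

Lemma integral_monotone_cvg (mu : {measure set T -> \bar R})
    (f_ : nat -> T -> \bar R) f :
  (forall n, measurable_fun setT (f_ n)) -> (forall n x, 0 <= f_ n x) ->
  (forall x, {homo f_^~ x : n m / (n <= m)%N >-> n <= m}) ->
  (forall x, f_ n x @[n --> \oo] --> f x) ->
  \int[mu]_x f_ n x @[n --> \oo] --> \int[mu]_x f x.
Proof.
move=> mf f0 ndf cf; rewrite (_ : f = fun x => limn (f_^~ x)).
  by apply: cvg_monotone_convergence.
by apply/funext => x; apply/esym/cvg_lim.
Qed.

End nneg_induction.

(** * Reversibility extended from sets to nonnegative functions *)

Section reversible_nneg.
Local Open Scope ereal_scope.
Context {d : measure_display} {T : measurableType d} {R : realType}.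
Variables (pi : probability T R) (K : R.-pker T ~> T).
Hypothesis K_rev : kreversible K pi.

Lemma measurable_kernel_integral (f : T -> \bar R) :
  measurable_fun setT f -> (forall x, 0 <= f x) ->
  measurable_fun setT (fun x => \int[K x]_y f y).
Proof.
by move=> mf f0; apply: measurable_fun_integral_kernel => // U; exact: measurable_kernel.
Qed.

Lemma integral_indic_mul (mu : {measure set T -> \bar R}) (B : set T)
    (f : T -> \bar R) :
  \int[mu]_(x in B) f x = \int[mu]_x ((\1_B x)%:E * f x).
Proof.
rewrite integral_mkcond; apply: eq_integral => x _.
by rewrite patchE indicE; case: ifPn => xB; rewrite ?mul1e ?mul0e.
Qed.

Lemma kernel_integral_linear x (k : R) (f g : T -> \bar R) : (0 <= k)%R ->
  measurable_fun setT f -> (forall x, 0 <= f x) ->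
  measurable_fun setT g -> (forall x, 0 <= g x) ->
  \int[K x]_y (k%:E * f y + g y) = k%:E * \int[K x]_y f y + \int[K x]_y g y.
Proof.
move=> k0 mf f0 mg g0; rewrite ge0_integralD//.
- by rewrite ge0_integralZl.
- by move=> *; rewrite mule_ge0.
- exact: measurable_funeM.
Qed.

(** The two sets of the reversibility identity are replaced by functions one at a time; here the
    first, with [B] fixed, and in [reversible_nneg] the second. *)
Lemma reversible_indic (B : set T) (f : T -> \bar R) : measurable B ->
  measurable_fun setT f -> (forall x, 0 <= f x) ->
  \int[pi]_x ((\1_B x)%:E * \int[K x]_y f y) = \int[pi]_x (K x B * f x).
Proof.
move=> mB; have mKB := measurable_kernel K _ mB.
have m1B : measurable_fun setT (fun x => (\1_B x : R)%:E).
  exact/measurable_EFinP/measurable_indic.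
have KBfin x : K x B \is a fin_num.
  rewrite ge0_fin_numE//; apply: (@le_lt_trans _ _ (K x setT)).
    by apply: le_measure => //; apply: mem_set.
  by rewrite prob_kernel ltry.
have m1 h : measurable_fun setT h -> (forall x, 0 <= h x) ->
    measurable_fun setT (fun x => (\1_B x)%:E * \int[K x]_y h y).
  by move=> mh h0; apply: emeasurable_funM => //; exact: measurable_kernel_integral.
have p1 h : (forall x, 0 <= h x) -> forall x, 0 <= (\1_B x)%:E * \int[K x]_y h y.
  by move=> h0 x; rewrite mule_ge0 ?lee_fin// integral_ge0.
move: f; apply: nneg_measurable_ind.
- move=> A mA; have := K_rev mA mB.
  rewrite (integral_indic_mul _ A) (integral_indic_mul _ B) => H.
  under eq_integral do rewrite integral_indic// setIT.
  by rewrite -H; apply: eq_integral => x _; rewrite muleC.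
- move=> k f g k0 mf f0 Pf mg g0 Pg.
  transitivity (\int[pi]_x (k%:E * ((\1_B x)%:E * \int[K x]_y f y) +
      (\1_B x)%:E * \int[K x]_y g y)).
    apply: eq_integral => x _; rewrite kernel_integral_linear//.
    by rewrite ge0_muleDr ?mule_ge0 ?integral_ge0// muleCA.
  transitivity (\int[pi]_x (k%:E * (K x B * f x) + K x B * g x)); last first.
    by apply: eq_integral => x _; rewrite muleCA ge0_muleDr ?mule_ge0.
  rewrite !ge0_integralD//.
  + rewrite !ge0_integralZl ?Pf ?Pg//; last 4 first.
    * exact: emeasurable_funM.
    * by move=> *; rewrite mule_ge0.
    * exact: m1.
    * by move=> *; exact: p1.
  + by move=> *; rewrite !mule_ge0.
  + by apply: measurable_funeM; exact: emeasurable_funM.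
  + by move=> *; rewrite !mule_ge0.
  + exact: emeasurable_funM.
  + by move=> *; rewrite mule_ge0 ?p1.
  + by apply: measurable_funeM; exact: m1.
  + by move=> *; exact: p1.
  + exact: m1.
- move=> f_ f mf f0 ndf cf Pf.
  have c1 : \int[pi]_x ((\1_B x)%:E * \int[K x]_y f_ n y) @[n --> \oo] -->
      \int[pi]_x ((\1_B x)%:E * \int[K x]_y f y).
    apply: integral_monotone_cvg.
    + by move=> n; exact: m1.
    + by move=> n; exact: p1.
    + move=> x a b ab; apply: lee_wpmul2l; first by rewrite lee_fin.
      by apply: ge0_le_integral => // y _; exact: ndf.
    + by move=> x; apply: cvgeZl => //; exact: integral_monotone_cvg.
  have c2 : \int[pi]_x (K x B * f_ n x) @[n --> \oo] --> \int[pi]_x (K x B * f x).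
    apply: integral_monotone_cvg.
    + by move=> n; exact: emeasurable_funM.
    + by move=> n x; rewrite mule_ge0.
    + by move=> x a b ab; apply: lee_wpmul2l => //; exact: ndf.
    + by move=> x; exact: cvgeZl.
  by move: c1; under eq_fun do rewrite Pf; move=> c1; exact: (cvg_unique _ c1 c2).
Qed.

Lemma reversible_nneg (f : T -> R) (g : T -> \bar R) :
  measurable_fun setT f -> (forall x, 0 <= f x)%R ->
  measurable_fun setT g -> (forall x, 0 <= g x) ->
  \int[pi]_x ((f x)%:E * \int[K x]_y g y) =
  \int[pi]_x (g x * \int[K x]_y (f y)%:E).
Proof.
move=> mf f0; have mfE : measurable_fun setT (EFin \o f) by exact/measurable_EFinP.
have fE0 x : 0 <= (f x)%:E by rewrite lee_fin.
have mKf := measurable_kernel_integral mfE fE0.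
have Kf0 x : 0 <= \int[K x]_y (f y)%:E by rewrite integral_ge0.
move: g; apply: nneg_measurable_ind.
- move=> B mB; rewrite reversible_indic//; apply: eq_integral => x _.
  by rewrite integral_indic// setIT muleC.
- move=> k g h k0 mg g0 Pg mh h0 Ph.
  have m1 u : measurable_fun setT u -> (forall x, 0 <= u x) ->
      measurable_fun setT (fun x => (f x)%:E * \int[K x]_y u y).
    by move=> mu u0; apply: emeasurable_funM => //; exact: measurable_kernel_integral.
  have p1 u : (forall x, 0 <= u x) -> forall x, 0 <= (f x)%:E * \int[K x]_y u y.
    by move=> u0 x; rewrite mule_ge0// integral_ge0.
  transitivity (\int[pi]_x (k%:E * ((f x)%:E * \int[K x]_y g y) +
      (f x)%:E * \int[K x]_y h y)).
    apply: eq_integral => x _; rewrite kernel_integral_linear//.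
    by rewrite ge0_muleDr ?mule_ge0 ?integral_ge0// muleCA.
  transitivity (\int[pi]_x (k%:E * (g x * \int[K x]_y (f y)%:E) +
      h x * \int[K x]_y (f y)%:E)); last first.
    by apply: eq_integral => x _; rewrite ge0_muleDl ?mule_ge0// muleA.
  rewrite !ge0_integralD//.
  + rewrite !ge0_integralZl ?Pg ?Ph//; last 4 first.
    * exact: emeasurable_funM.
    * by move=> *; rewrite mule_ge0.
    * exact: m1.
    * by move=> *; exact: p1.
  + by move=> *; rewrite !mule_ge0.
  + by apply: measurable_funeM; exact: emeasurable_funM.
  + by move=> *; rewrite !mule_ge0.
  + exact: emeasurable_funM.
  + by move=> *; rewrite mule_ge0 ?p1.
  + by apply: measurable_funeM; exact: m1.
  + by move=> *; exact: p1.
  + exact: m1.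
- move=> g_ g mg g0 ndg cg Pg.
  have c1 : \int[pi]_x ((f x)%:E * \int[K x]_y g_ n y) @[n --> \oo] -->
      \int[pi]_x ((f x)%:E * \int[K x]_y g y).
    apply: integral_monotone_cvg.
    + move=> n; apply: emeasurable_funM => //; exact: measurable_kernel_integral.
    + by move=> n x; rewrite mule_ge0// integral_ge0.
    + move=> x a b ab; apply: lee_wpmul2l => //.
      by apply: ge0_le_integral => // y _; exact: ndg.
    + by move=> x; apply: cvgeZl => //; exact: integral_monotone_cvg.
  have c2 : \int[pi]_x (g_ n x * \int[K x]_y (f y)%:E) @[n --> \oo] -->
      \int[pi]_x (g x * \int[K x]_y (f y)%:E).
    apply: integral_monotone_cvg.
    + by move=> n; exact: emeasurable_funM.
    + by move=> n x; rewrite mule_ge0.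
    + by move=> x a b ab; apply: lee_wpmul2r => //; exact: ndg.
    (* If the kernel integral of [f] is infinite, the product is continuous unless [g x = 0]; then
       every [g_ n x] is already 0 by monotonicity. *)
    + move=> x; have [Kfin|Kinf] := boolP (\int[K x]_y (f y)%:E \is a fin_num).
        exact: cvgeZr.
      have [gx0|gx0] := eqVneq (g x) 0.
        have gn0 n : g_ n x = 0.
          have cs := ereal_nondecreasing_cvgn (ndg x).
          apply/eqP; rewrite eq_le g0 andbT -gx0 -(cvg_unique _ cs (cg x))//.
          by apply: ereal_sup_ubound; exists n.
        by under eq_fun do rewrite gn0 mul0e; rewrite gx0 mul0e; exact: cvg_cst.
      apply: cvgeM => //; last exact: cvg_cst.
      have -> : \int[K x]_y (f y)%:E = +oo.
        by apply/eqP; move: Kinf; rewrite ge0_fin_numE// -leNgt leye_eq.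
      by rewrite mule_defE (negbTE gx0).
  by move: c1; under eq_fun do rewrite Pg; move=> c1; exact: (cvg_unique _ c1 c2).
Qed.

End reversible_nneg.

(** * Square-integrable functions and their form *)

Section square_integrable.
Context {d : measure_display} {T : measurableType d} {R : realType}.
Implicit Types (mu : {measure set T -> \bar R}) (f g : T -> R).

Definition sqint mu f : Prop := measurable_fun setT f /\
  mu.-integrable setT (EFin \o (fun x => f x ^+ 2)).

Lemma sqintP mu f : sqint mu f <->
  measurable_fun setT f /\ (\int[mu]_x ((f x) ^+ 2)%:E < +oo)%E.
Proof.
split=> -[mf sf]; split=> //.
  by have /integrableP[_] := sf; under eq_integral do rewrite /= ger0_norm ?sqr_ge0//.
apply/integrableP; split; first by apply/measurable_EFinP/measurable_funX.
by under eq_integral do rewrite /= ger0_norm ?sqr_ge0//.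
Qed.

Lemma sqint_le mu f g : measurable_fun setT f -> sqint mu g ->
  (forall x, f x ^+ 2 <= g x ^+ 2) -> sqint mu f.
Proof.
move=> mf [_ sg] fg; split=> //; apply: le_integrable sg => //.
  by apply/measurable_EFinP/measurable_funX.
by move=> x _; rewrite /= lee_fin !ger0_norm ?sqr_ge0.
Qed.

Lemma integrable_mul mu f g : sqint mu f -> sqint mu g ->
  mu.-integrable setT (EFin \o (fun x => f x * g x)).
Proof.
move=> [mf sf] [mg sg].
apply: (le_integrable measurableT _ _ (integrableD measurableT sf sg)).
  by apply/measurable_EFinP/measurable_funM.
move=> x _; rewrite /= lee_fin (ger0_norm (addr_ge0 _ _)) ?sqr_ge0// ler_norml.
by have := sqr_ge0 (f x + g x); have := sqr_ge0 (f x - g x);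
  have := sqr_ge0 (f x); have := sqr_ge0 (g x); nra.
Qed.

Lemma sqint_lin mu a f g : sqint mu f -> sqint mu g -> sqint mu (a *: f + g).
Proof.
move=> [mf sf] [mg sg].
have ml : measurable_fun setT (a *: f + g).
  by apply: measurable_funD => //; exact: measurable_funM.
split=> //.
have sf' := integrableZl measurableT (2 * a ^+ 2) sf.
have sg' := integrableZl measurableT 2 sg.
apply: (le_integrable measurableT _ _ (integrableD measurableT sf' sg')).
  by apply/measurable_EFinP/measurable_funX.
move=> x _; rewrite /= lee_fin !ger0_norm ?sqr_ge0//; last first.
  by have := sqr_ge0 (a * f x); have := sqr_ge0 (g x); nra.
rewrite (_ : (a *: f + g) x = a * f x + g x)//.
by have := sqr_ge0 (a * f x - g x); nra.
Qed.

Definition l2dot mu f g : R := \int[mu]_x (f x * g x).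

Lemma l2dotE mu f : sqint mu f -> (l2dot mu f f)%:E = (\int[mu]_x ((f x) ^+ 2)%:E)%E.
Proof.
move=> [mf sf]; rewrite /l2dot /Rintegral fineK.
  by under eq_integral do rewrite -expr2.
by under eq_integral do rewrite -expr2; exact: integrable_fin_num.
Qed.

Lemma sqint0 mu : sqint mu 0.
Proof.
split; first exact: measurable_cst.
apply: (eq_integrable measurableT (cst 0%E)); last exact: integrable0.
by move=> x _ /=; rewrite expr0n.
Qed.

Lemma sqint_semi_inner mu : semi_inner (sqint mu) (l2dot mu).
Proof.
split.
- exact: sqint0.
- by move=> *; exact: sqint_lin.
- move=> a f g h sf sg sh; rewrite /l2dot.
  rewrite -RintegralZl//; last exact: integrable_mul.
  rewrite -RintegralD//; last exact: integrable_mul; last first.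
    exact: (integrableZl measurableT a (integrable_mul sf sh)).
  by apply: eq_Rintegral => x _; rewrite mulrDl -mulrA.
- by move=> f g _ _; apply: eq_Rintegral => x _; rewrite mulrC.
- by move=> f _; apply: Rintegral_ge0 => x _; rewrite -expr2 sqr_ge0.
Qed.

Lemma eq_l2dot mu f g h : sqint mu f -> sqint mu g -> sqint mu h ->
  {ae mu, forall x, f x = g x} -> l2dot mu f h = l2dot mu g h.
Proof.
move=> [mf _] [mg _] [mh _] fg; congr fine; apply: ae_eq_integral => //.
- by apply/measurable_EFinP/measurable_funM.
- by apply/measurable_EFinP/measurable_funM.
- by apply: filterS fg => x fgx _; rewrite fgx.
Qed.

Lemma l2dot_eq0 mu f : sqint mu f -> l2dot mu f f = 0 -> {ae mu, forall x, f x = 0}.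
Proof.
move=> [mf sf] f0.
have : (\int[mu]_x `|((f x) ^+ 2)%:E| = 0)%E.
  under eq_integral do rewrite /= ger0_norm ?sqr_ge0//.
  by rewrite -l2dotE// f0.
move/(ae_eq_integral_abs mu measurableT) => H.
have : ae_eq mu setT (fun x => ((f x) ^+ 2)%:E) (cst 0%E).
  by apply: H; apply/measurable_EFinP/measurable_funX.
by apply: filterS => x /(_ Logic.I) [] /eqP; rewrite sqrf_eq0 => /eqP.
Qed.

Lemma ae_Rintegral_ge0 mu f : mu.-integrable setT (EFin \o f) ->
  {ae mu, forall x, 0 <= f x} -> 0 <= \int[mu]_x f x.
Proof.
move=> intf f0; have mf := measurable_int _ intf.
rewrite /Rintegral (ae_eq_integral (fun x => `|(f x)%:E|%E))//.
- by apply: fine_ge0; exact: integral_ge0.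
- exact: measurableT_comp.
- by apply: filterS f0 => x fx0 _; rewrite /= ger0_norm.
Qed.

Section probability.
Variable mu : {measure set T -> \bar R}.
Hypothesis mu1 : mu setT = 1%E.

Lemma sqint_cst r : sqint mu (cst r).
Proof.
apply/sqintP; split; first exact: measurable_cst.
by rewrite (integral_cst mu measurableT (r ^+ 2)%:E) mu1 mule1 ltry.
Qed.

Lemma sqint_integrable f : sqint mu f -> mu.-integrable setT (EFin \o f).
Proof.
move=> sf; have := integrable_mul sf (sqint_cst 1).
by congr (mu.-integrable setT _); apply/funext => x /=; rewrite mulr1.
Qed.

Lemma l2dot1 f : l2dot mu f (cst 1) = \int[mu]_x f x.
Proof. by apply: eq_Rintegral => x _; rewrite mulr1. Qed.

(** Used with [a] the mean of [f], where it yields the variance inequality, and with [mu = K x],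
    [a = f x], where it is the inner integral of the energy. *)
Lemma Rintegral_sqrB a e f : sqint mu f ->
  \int[mu]_y ((a - e * f y) ^+ 2) =
  a ^+ 2 - 2 * a * e * (\int[mu]_y f y) + e ^+ 2 * (\int[mu]_y (f y ^+ 2)).
Proof.
move=> sf; have SI := sqint_semi_inner mu.
have sa := sqint_cst a.
have e1 : l2dot mu (cst a) (cst a) = a ^+ 2.
  by rewrite /l2dot (Rintegral_cst mu measurableT (a * a)) mu1 mulr1 -expr2.
have e2 : l2dot mu (cst a) f = a * \int[mu]_y f y.
  by rewrite -RintegralZl//; exact: sqint_integrable.
have e3 : l2dot mu f f = \int[mu]_y (f y ^+ 2).
  by apply: eq_Rintegral => x _; rewrite expr2.
transitivity (l2dot mu (cst a - e *: f) (cst a - e *: f)).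
  by apply: eq_Rintegral => x _; rewrite expr2.
by rewrite (semi_sqrB SI)// e1 e2 e3; ring.
Qed.

Lemma sqr_Rintegral_le f : sqint mu f ->
  (\int[mu]_y f y) ^+ 2 <= \int[mu]_y (f y ^+ 2).
Proof.
move=> sf; set m := \int[mu]_y f y.
have : 0 <= \int[mu]_y ((m - 1 * f y) ^+ 2).
  by apply: Rintegral_ge0 => x _; exact: sqr_ge0.
by rewrite Rintegral_sqrB// -/m; lra.
Qed.

End probability.
End square_integrable.

(** * Geometrically dominated real series *)

Section geometric_series.
Context {R : realType}.

Lemma sum_geometric_le (M t : R) n : 0 <= M -> 0 <= t -> t < 1 ->
  \sum_(i < n) (M * t ^+ i) <= M / (1 - t).
Proof.
move=> M0 t0 t1; have t10 : 0 < 1 - t by rewrite subr_gt0.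
rewrite ler_pdivlMr// -big_distrr /= -mulrA ler_piMr//.
suff -> : (\sum_(i < n) t ^+ i) * (1 - t) = 1 - t ^+ n.
  by rewrite gerBl exprn_ge0.
elim: n => [|n IHn]; first by rewrite big_ord0 expr0 mul0r subrr.
by rewrite big_ord_recr /= mulrDl IHn exprS; ring.
Qed.

(** Beyond [N], any number [k] of further terms contributes at most the stated remainder; this
    uniform bound survives the limit in [k]. *)
Lemma geometric_series_limit (u : nat -> R) (M t : R) : 0 <= t -> t < 1 ->
  (forall n, `|u n| <= M * t ^+ n) ->
  exists2 l, (\sum_(i < n) u i) @[n --> \oo] --> l &
    forall N, `|l - \sum_(i < N) u i| <= M * t ^+ N / (1 - t).
Proof.
move=> t0 t1 uM.
have M0 : 0 <= M by have := uM 0%N; rewrite expr0 mulr1; exact: le_trans.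
have cu : cvgn (series u).
  apply: normed_cvg; apply: (@series_le_cvg _ _ (geometric M t)) => //.
  - by move=> n; exact: normr_ge0.
  - by move=> n; rewrite /geometric /= mulr_ge0// exprn_ge0.
  - by apply: is_cvg_geometric_series; rewrite ger0_norm.
have sE : series u = fun n => \sum_(i < n) u i.
  by apply/funext => n; rewrite /series /= big_mkord.
rewrite sE in cu; exists (limn (fun n => \sum_(i < n) u i)) => // N.
have tail k : `|\sum_(i < k + N) u i - \sum_(i < N) u i| <= M * t ^+ N / (1 - t).
  rewrite -!(big_mkord xpredT u) (big_cat_nat (n:=N))//= ?leq_addl//.
  rewrite (addrC (\sum_(0 <= i < N) u i)) addrK -{1}[N]add0n big_addn addnK big_mkord.
  rewrite (le_trans (ler_norm_sum _ _ _))//.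
  apply: le_trans (sum_geometric_le k _ t0 t1); last by rewrite mulr_ge0// exprn_ge0.
  apply: ler_sum => i _; rewrite (le_trans (uM _))//.
  by rewrite exprD -mulrA [t ^+ i * _]mulrC.
have cuN : cvgn (fun n => \sum_(i < n + N) u i).
  move/cvg_ex : cu => [l cl]; apply/cvg_ex; exists l.
  by move: cl; rewrite -(cvg_shiftn N).
have -> : limn (fun n => \sum_(i < n) u i) = limn (fun n => \sum_(i < n + N) u i).
  apply/esym/cvg_lim; first exact: Rhausdorff.
  by rewrite (cvg_shiftn N (fun n => \sum_(i < n) u i)).
rewrite ler_norml lerBrDr lerBlDr; apply/andP; split.
  apply: limr_ge => //; apply: nearW => k.
  by have := tail k; rewrite ler_norml lerBrDr => /andP[].
apply: limr_le => //; apply: nearW => k.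
by have := tail k; rewrite ler_norml lerBlDr => /andP[].
Qed.

End geometric_series.

(** * Completeness of [L^2] *)

Section completeness.
Context {d : measure_display} {T : measurableType d} {R : realType}.
Variable mu : {measure set T -> \bar R}.

(* The majorant [S = \sum_n p^-n h_n^2], with [p ^+ 2 = r], is integrable and
   gives [|h_n| <= sqrt S * sqrt p ^+ n] wherever it is finite. *)
Lemma sqint_complete (h : nat -> T -> R) (r C : R) :
  (forall n, sqint mu (h n)) -> 0 < r -> r < 1 ->
  (forall n, l2dot mu (h n) (h n) <= C * r ^+ n) ->
  exists2 f, sqint mu f & exists C' r' : R, [/\ 0 <= r', r' < 1 &
    forall n, l2dot mu (f - \sum_(i < n) h i) (f - \sum_(i < n) h i) <= C' * r' ^+ n].
Proof.
move=> sh r0 r1 hC; have SI := sqint_semi_inner mu.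
(* The weight [p^-n] spends half of the decay [r^n = p^(2n)]: the rest, [p^n], makes [S] integrable.
   A second square root [t] appears because [h_n^2 <= S * p^n] is turned into a bound on [|h_n|]. *)
pose p := Num.sqrt r; have p0 : 0 < p by rewrite sqrtr_gt0.
have pp : p ^+ 2 = r by rewrite sqr_sqrtr// ltW.
have p1 : p < 1 by rewrite -sqrtr1 ltr_sqrt.
pose t := Num.sqrt p; have t0 : 0 < t by rewrite sqrtr_gt0.
have tt : t ^+ 2 = p by rewrite sqr_sqrtr// ltW.
have t1 : t < 1 by rewrite -sqrtr1 ltr_sqrt.
have C0 : 0 <= C.
  by have := hC 0%N; rewrite expr0 mulr1; apply: le_trans; exact: (semi_ge0 SI).
have mh n : measurable_fun setT (h n) by have [] := sh n.
pose G n x := ((p ^- n)%:E * ((h n x) ^+ 2)%:E)%E.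
have mG n : measurable_fun setT (G n).
  by apply: measurable_funeM; exact/measurable_EFinP/measurable_funX.
have G0 n x : (0 <= G n x)%E.
  by rewrite mule_ge0 ?lee_fin ?sqr_ge0// invr_ge0 exprn_ge0// ltW.
pose S x := (\sum_(0 <= n <oo) G n x)%E.
have mS : measurable_fun setT S by exact: ge0_emeasurable_sum.
have S0 x : (0 <= S x)%E by exact: nneseries_ge0.
have intS : (\int[mu]_x S x <= (C / (1 - p))%:E)%E.
  rewrite integral_nneseries//; apply: lime_le.
    by apply: is_cvg_nneseries => n _ _; exact: integral_ge0.
  apply: nearW => N; rewrite big_mkord.
  apply: (@le_trans _ _ (\sum_(n < N) (C * p ^+ n))%:E); last first.
    by rewrite lee_fin sum_geometric_le// ltW.
  rewrite -sumEFin; apply: lee_sum => n _; rewrite ge0_integralZl//; first last.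
  - by rewrite lee_fin invr_ge0 exprn_ge0// ltW.
  - by move=> x _; rewrite lee_fin sqr_ge0.
  - exact/measurable_EFinP/measurable_funX.
  rewrite -l2dotE// -EFinM lee_fin mulrC ler_pdivrMr ?exprn_gt0//.
  by rewrite (le_trans (hC n))// -pp -mulrA -exprD addnn -exprM mul2n.
have Sfin : {ae mu, forall x, S x \is a fin_num}.
  have iS : mu.-integrable setT S.
    apply/integrableP; split=> //; under eq_integral do rewrite gee0_abs//.
    by rewrite (le_lt_trans intS)// ltry.
  by have := integrable_ae measurableT iS; apply: filterS => x; exact.
(* An upper limit is measurable without any convergence; it is the sum of the series wherever [S] is
   finite. *)
pose f x := fine (limn_esup (fun n => (\sum_(i < n) h i x)%:E)).
have mf : measurable_fun setT f.
  apply: (measurableT_comp (@fine_measurable _ _ measurableT)) => //.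
  apply: measurable_fun_limn_esup => n; apply/measurable_EFinP.
  under eq_fun do rewrite -(big_mkord xpredT (h^~ _)).
  exact: measurable_sum.
have sumE n x : (\sum_(i < n) h i) x = \sum_(i < n) h i x.
  by elim: n => [|n IHn]; rewrite ?big_ord0// !big_ord_recr/= -IHn.
have mfn n : measurable_fun setT (f - \sum_(i < n) h i).
  apply: measurable_funB => //.
  rewrite (_ : \sum_(i < n) h i = fun x => \sum_(0 <= i < n) h i x).
    exact: measurable_sum.
  by apply/funext => x; rewrite sumE big_mkord.
have bound n : (\int[mu]_x (((f - \sum_(i < n) h i) x) ^+ 2)%:E <=
    (p ^+ n / (1 - t) ^+ 2 * (C / (1 - p)))%:E)%E.
  apply: (@le_trans _ _ (\int[mu]_x ((p ^+ n / (1 - t) ^+ 2)%:E * S x))%E).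
    apply: ae_ge0_le_integral => //.
    - by move=> x _; rewrite lee_fin sqr_ge0.
    - exact/measurable_EFinP/measurable_funX.
    - move=> x _; rewrite mule_ge0// lee_fin divr_ge0 ?sqr_ge0//.
      by rewrite exprn_ge0// ltW.
    - exact: measurable_funeM.
    apply: filterS Sfin => x Sx _.
    have hS k : `|h k x| <= Num.sqrt (fine (S x)) * t ^+ k.
      rewrite -ler_sqr ?nnegrE ?mulr_ge0 ?sqrtr_ge0 ?exprn_ge0 ?(ltW t0)//.
      rewrite real_normK ?num_real// exprMn sqr_sqrtr ?fine_ge0//.
      rewrite -exprM mulnC exprM tt -ler_pdivrMr ?exprn_gt0// -lee_fin fineK//.
      apply: (@le_trans _ _ (\sum_(0 <= i < k.+1) G i x)%E).
        by rewrite big_nat_recr//= mulrC EFinM; apply: leeDr; exact: sume_ge0.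
      exact: nneseries_lim_ge.
    have [l cl lN] := geometric_series_limit (ltW t0) t1 hS.
    have fl : f x = l.
      have cE : (fun n => (\sum_(i < n) h i x)%:E) @ \oo --> l%:E.
        by apply: cvg_EFin => //; exact: nearW.
      by rewrite /f (cvg_limn_einf_sup cE).2.
    rewrite -[S x]fineK// -EFinM lee_fin.
    rewrite (_ : (f - _) x = l - \sum_(i < n) h i x); last by rewrite -fl -sumE.
    rewrite -[leLHS]real_normK ?num_real//.
    apply: (@le_trans _ _ ((Num.sqrt (fine (S x)) * t ^+ n / (1 - t)) ^+ 2)).
      rewrite ler_sqr ?nnegrE// (le_trans _ (lN n))//.
    rewrite !exprMn sqr_sqrtr ?fine_ge0// -[t ^+ n ^+ 2]exprM mulnC exprM tt.
    by rewrite exprVn -mulrA mulrC.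
  rewrite ge0_integralZl//; last first.
    by rewrite lee_fin divr_ge0 ?sqr_ge0// exprn_ge0// ltW.
  rewrite [leRHS]EFinM; apply: lee_wpmul2l => //.
  by rewrite lee_fin divr_ge0 ?sqr_ge0// exprn_ge0// ltW.
have sfn n : sqint mu (f - \sum_(i < n) h i).
  by apply/sqintP; split=> //; rewrite (le_lt_trans (bound n))// ltry.
(* Square integrability of [f] is the remainder bound at [n = 0]. *)
exists f; first by have := sfn 0%N; rewrite big_ord0 subr0.
exists (C / (1 - p) / (1 - t) ^+ 2), p; split => //; first exact: ltW.
move=> n; rewrite -lee_fin l2dotE// (le_trans (bound n))// lee_fin.
by rewrite mulrC -mulrA [p ^+ n / _]mulrC mulrA.
Qed.

End completeness.

(** * A reversible kernel as a symmetric contraction of [L^2(pi)] *)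

Section kernel_action.
Context {d : measure_display} {T : measurableType d} {R : realType}.
Implicit Types f g : T -> R.

Lemma measurable_kact (K : R.-pker T ~> T) f :
  measurable_fun setT f -> measurable_fun setT (kact K f).
Proof.
move=> mf; have mfE : measurable_fun setT (EFin \o f) by exact/measurable_EFinP.
apply: (measurableT_comp (@fine_measurable _ _ measurableT)) => //.
under eq_fun do rewrite integralE.
apply: emeasurable_funB; apply: measurable_kernel_integral => //.
  exact: measurable_funepos.
exact: measurable_funeneg.
Qed.

Lemma kactB (K : R.-pker T ~> T) f g x : sqint (K x) f -> sqint (K x) g ->
  kact K (f - g) x = kact K f x - kact K g x.
Proof.
move=> sf sg; have K1 := @prob_kernel _ _ _ _ _ K x.
by rewrite /kact -RintegralB//; exact: (sqint_integrable K1).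
Qed.

Lemma kact_cst (K : R.-pker T ~> T) r : kact K (cst r) = cst r.
Proof.
apply/funext => x; rewrite /kact (integral_cst (K x) measurableT r%:E).
by rewrite prob_kernel mule1.
Qed.

Variables (pi : probability T R) (K : R.-pker T ~> T).
Hypothesis K_rev : kreversible K pi.
Let pi1 : pi setT = 1%E := probability_setT pi.

(** Reversibility tested against the constant 1: [pi] is invariant. *)
Lemma reversible_integral f : measurable_fun setT f -> (forall x, 0 <= f x) ->
  (\int[pi]_x \int[K x]_y (f y)%:E = \int[pi]_x (f x)%:E)%E.
Proof.
move=> mf f0; have := @reversible_nneg _ _ _ pi K K_rev (cst 1) (EFin \o f).
rewrite (_ : (fun x => _ * _)%E = (fun x => \int[K x]_y (f y)%:E)%E); last first.
  by apply/funext => x; rewrite mul1e.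
move=> ->//; first last.
- exact/measurable_EFinP.
- apply: eq_integral => x _.
  by rewrite (integral_cst _ measurableT 1%E) prob_kernel !mule1.
Qed.

Lemma integrable_kernel_integral f : measurable_fun setT f -> (forall x, 0 <= f x) ->
  pi.-integrable setT (EFin \o f) ->
  pi.-integrable setT (fun x => \int[K x]_y (f y)%:E)%E.
Proof.
move=> mf f0 /integrableP[mfE intf]; apply/integrableP; split.
  by apply: measurable_kernel_integral => // x; rewrite lee_fin.
under eq_integral.
  by move=> x _; rewrite gee0_abs; [over|apply: integral_ge0 => y _; rewrite lee_fin].
rewrite reversible_integral//; move: intf.
by under eq_integral do rewrite /= ger0_norm//.
Qed.

(** By invariance the integral of [f^2] against [K x] has finite [pi]-mean, hence is finite for
    almost every [x]. *)
Lemma ae_sqint_kernel f : sqint pi f -> {ae pi, forall x, sqint (K x) f}.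
Proof.
move=> [mf sf]; have mf2 : measurable_fun setT (fun x => f x ^+ 2).
  exact: measurable_funX.
have f2 x : 0 <= f x ^+ 2 by exact: sqr_ge0.
have := integrable_ae measurableT (integrable_kernel_integral mf2 f2 sf).
apply: filterS => x /(_ Logic.I) fin; apply/sqintP; split=> //.
by rewrite -ge0_fin_numE//; apply: integral_ge0 => y _; rewrite lee_fin.
Qed.

(** The variance inequality for [K x]; if the right side is infinite there is nothing to prove, so
    it holds at every [x]. *)
Lemma kact_sqr_le f x : measurable_fun setT f ->
  (((kact K f x) ^+ 2)%:E <= \int[K x]_y ((f y) ^+ 2)%:E)%E.
Proof.
move=> mf; have K1 := @prob_kernel _ _ _ _ _ K x.
have [f2|] := ltP (\int[K x]_y ((f y) ^+ 2)%:E)%E +oo%E; last first.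
  by rewrite leye_eq => /eqP ->; rewrite leey.
have sf : sqint (K x) f by apply/sqintP.
have := sqr_Rintegral_le K1 sf; rewrite -lee_fin /Rintegral fineK//.
by rewrite ge0_fin_numE// integral_ge0// => y _; rewrite lee_fin sqr_ge0.
Qed.

Lemma kact_sqr_integral_le f : measurable_fun setT f ->
  (\int[pi]_x ((kact K f x) ^+ 2)%:E <= \int[pi]_x ((f x) ^+ 2)%:E)%E.
Proof.
move=> mf; have mf2 : measurable_fun setT (fun x => f x ^+ 2).
  exact: measurable_funX.
have mkf := measurable_kact K mf.
rewrite -[leRHS]reversible_integral//; last by move=> x; exact: sqr_ge0.
apply: ge0_le_integral => //.
- by move=> x _; rewrite lee_fin sqr_ge0.
- by apply/measurable_EFinP/measurable_funX.
- apply: measurable_kernel_integral; first exact/measurable_EFinP.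
  by move=> x; rewrite lee_fin sqr_ge0.
- by move=> x _; exact: kact_sqr_le.
Qed.

Lemma kact_sqint f : sqint pi f -> sqint pi (kact K f).
Proof.
move=> /sqintP[mf sf]; apply/sqintP; split; first exact: measurable_kact.
exact: le_lt_trans (kact_sqr_integral_le mf) sf.
Qed.

Lemma kact_contraction f : sqint pi f ->
  l2dot pi (kact K f) (kact K f) <= l2dot pi f f.
Proof.
move=> sf; have sk := kact_sqint sf; rewrite -lee_fin !l2dotE//.
by case: sf => mf _; exact: kact_sqr_integral_le.
Qed.

Lemma ae_kactB f g : sqint pi f -> sqint pi g ->
  {ae pi, forall x, kact K (f - g) x = (kact K f - kact K g) x}.
Proof.
move=> sf sg; have := ae_sqint_kernel sf; have := ae_sqint_kernel sg.
by apply: filterS2 => x sgx sfx; rewrite kactB.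
Qed.

(** Reversibility equates integrals in the extended reals; the truncation by [fine] in [kact]
    changes them only on a null set. *)
Lemma kact_sym_nneg f g : sqint pi f -> (forall x, 0 <= f x) ->
  sqint pi g -> (forall x, 0 <= g x) ->
  l2dot pi (kact K f) g = l2dot pi f (kact K g).
Proof.
have half u v : sqint pi u -> (forall x, 0 <= u x) ->
    sqint pi v -> (forall x, 0 <= v x) ->
    (\int[pi]_x (kact K u x * v x)%:E =
     \int[pi]_x ((v x)%:E * \int[K x]_y (u y)%:E))%E.
  move=> su u0 sv v0; have [mu _] := su; have [mv _] := sv.
  have mku := measurable_kact K mu.
  apply: ge0_ae_eq_integral => //.
  - exact/measurable_EFinP/measurable_funM.
  - apply: emeasurable_funM; first exact/measurable_EFinP.
    apply: measurable_kernel_integral; first exact/measurable_EFinP.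
    by move=> x; rewrite lee_fin.
  - move=> x _; rewrite lee_fin mulr_ge0// fine_ge0// integral_ge0// => y _.
    by rewrite lee_fin.
  - move=> x _; rewrite mule_ge0 ?lee_fin// integral_ge0// => y _.
    by rewrite lee_fin.
  - apply: filterS (ae_sqint_kernel su) => x sux _.
    rewrite EFinM muleC /kact fineK//; apply: integrable_fin_num => //.
    exact: (sqint_integrable (prob_kernel x) sux).
move=> sf f0 sg g0; rewrite /l2dot /Rintegral half//.
under [in RHS]eq_integral do rewrite mulrC.
rewrite half//; congr fine.
have [mf _] := sf; have [mg _] := sg.
rewrite (reversible_nneg K_rev mg g0)//; first exact/measurable_EFinP.
Qed.

Lemma sqint_pos_neg f : sqint pi f -> exists u v,
  [/\ sqint pi u, sqint pi v, (forall x, 0 <= u x), (forall x, 0 <= v x) & f = u - v].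
Proof.
move=> sf; have [mf _] := sf.
exists (fun x => Num.max (f x) 0), (fun x => Num.max (- f x) 0); split.
- apply: sqint_le sf _; first exact: measurable_maxr.
  by move=> x /=; have [h|h] := leP (f x) 0; rewrite ?lexx ?expr0n ?sqr_ge0.
- apply: sqint_le sf _; first by apply: measurable_maxr => //; exact: measurableT_comp.
  by move=> x /=; have [h|h] := leP (- f x) 0; rewrite ?sqrrN ?lexx ?expr0n ?sqr_ge0.
- by move=> x; rewrite le_max lexx orbT.
- by move=> x; rewrite le_max lexx orbT.
- apply/funext => x; rewrite -[RHS]/(Num.max (f x) 0 - Num.max (- f x) 0).
  by case: ltP => fx; case: ltP => fx'; lra.
Qed.

(** Both arguments are split into positive and negative parts. Since [kact] respects the splitting
    only almost everywhere, each split passes through [eq_l2dot]. *)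
Lemma kact_sym f g : sqint pi f -> sqint pi g ->
  l2dot pi (kact K f) g = l2dot pi f (kact K g).
Proof.
have SI := sqint_semi_inner pi.
have half u v : sqint pi u -> sqint pi v -> (forall x, 0 <= v x) ->
    l2dot pi (kact K u) v = l2dot pi u (kact K v).
  move=> su sv v0; have [p [n [sp sn p0 n0 uE]]] := sqint_pos_neg su.
  have skp := kact_sqint sp; have skn := kact_sqint sn; have skv := kact_sqint sv.
  have sku := kact_sqint su.
  rewrite uE in sku *.
  rewrite (eq_l2dot sku (semi_domB SI skp skn) sv (ae_kactB sp sn)).
  by rewrite !(semiBl SI)// !kact_sym_nneg.
move=> sf sg; have [p [n [sp sn p0 n0 gE]]] := sqint_pos_neg sg.
have skp := kact_sqint sp; have skn := kact_sqint sn; have skf := kact_sqint sf.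
have skg := kact_sqint sg; rewrite gE in skg *.
rewrite (semi_sym SI skf (semi_domB SI sp sn)) (semiBl SI sp sn skf).
rewrite (semi_sym SI sp skf) (semi_sym SI sn skf) !half//.
rewrite (semi_sym SI sf skg) (eq_l2dot skg (semi_domB SI skp skn) sf (ae_kactB sp sn)).
by rewrite (semiBl SI skp skn sf) (semi_sym SI skp sf) (semi_sym SI skn sf).
Qed.

End kernel_action.

(** * Mean-zero functions, and the resolvent in terms of forms *)

Section mean_zero.
Context {d : measure_display} {T : measurableType d} {R : realType}.
Variable pi : probability T R.
Implicit Types (K : R.-pker T ~> T) (f g : T -> R).
Let pi1 : pi setT = 1%E := probability_setT pi.

(** Mean zero as orthogonality to the constant 1: kernels preserve it by symmetry, limits by
    Cauchy-Schwarz. *)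
Lemma inL20P f : inL20 pi f <-> sqint pi f /\ l2dot pi f (cst 1) = 0.
Proof.
split=> [[mf [sf f0]]|[sf f0]].
  by split; [exact/sqintP|rewrite l2dot1 /Rintegral f0].
have [mf lf] := (sqintP _ _).1 sf; split=> //; split=> //.
have /(integrable_fin_num measurableT) If := sqint_integrable pi1 sf.
by rewrite -[LHS]fineK//; congr EFin; rewrite -[RHS]f0 l2dot1.
Qed.

Lemma inL20_semi_inner : semi_inner (inL20 pi) (l2dot pi).
Proof.
have SI := sqint_semi_inner pi; have s1 := sqint_cst pi1 1.
split.
- by apply/inL20P; rewrite (semi0l SI)//; split=> //; exact: sqint0.
- move=> a f g /inL20P[sf f0] /inL20P[sg g0]; apply/inL20P.
  by rewrite (semi_linear SI)// f0 g0 mulr0 addr0; split=> //; exact: sqint_lin.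
- move=> a f g h /inL20P[sf _] /inL20P[sg _] /inL20P[sh _].
  exact: (semi_linear SI).
- by move=> f g /inL20P[sf _] /inL20P[sg _]; exact: (semi_sym SI).
- by move=> f /inL20P[sf _]; exact: (semi_ge0 SI).
Qed.

Lemma inL20_complete (h : nat -> T -> R) (r C : R) :
  (forall n, inL20 pi (h n)) -> 0 < r -> r < 1 ->
  (forall n, l2dot pi (h n) (h n) <= C * r ^+ n) ->
  exists2 f, inL20 pi f & exists C' r' : R, [/\ 0 <= r', r' < 1 &
    forall n, l2dot pi (f - \sum_(i < n) h i) (f - \sum_(i < n) h i) <= C' * r' ^+ n].
Proof.
move=> Dh r0 r1 hC; have SI := sqint_semi_inner pi; have s1 := sqint_cst pi1 1.
have sh n : sqint pi (h n) by have /inL20P[] := Dh n.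
have [f sf [C' [r' [r'0 r'1 fC]]]] := sqint_complete sh r0 r1 hC.
exists f; last by exists C', r'.
apply/inL20P; split=> //; apply: (@eq0_of_sqr_le_geometric _ _ C' _ r'0 r'1) => n.
have ss := semi_dom_sum SI n sh.
have sum0 : l2dot pi (\sum_(i < n) h i) (cst 1) = 0.
  by rewrite (semi_suml SI)// big1// => i _; have /inL20P[] := Dh i.
rewrite -[l2dot _ _ _]subr0 -sum0 -(semiBl SI)//.
apply: le_trans (semi_cauchy_schwarz SI (semi_domB SI sf ss) s1) _.
have -> : l2dot pi (cst 1) (cst 1) = 1.
  by rewrite l2dot1 (Rintegral_cst pi measurableT 1) mul1r; exact: (congr1 fine pi1).
by rewrite mulr1; exact: fC.
Qed.

Section signed_kernel.
Variable K : R.-pker T ~> T.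
Hypothesis K_rev : kreversible K pi.
Variable e : R.
Hypothesis ee : e * e = 1.

(** As [e * e = 1], this is [K] or [-K]; the top of the spectrum of [-K] is the bottom of that of
    [K]. *)
Definition signed_kact f : T -> R := e *: kact K f.

Lemma kact_inL20 f : inL20 pi f -> inL20 pi (kact K f).
Proof.
move=> /inL20P[sf f0]; apply/inL20P; split; first exact: kact_sqint.
by rewrite kact_sym ?kact_cst//; exact: sqint_cst.
Qed.

Lemma signed_dom f : inL20 pi f -> inL20 pi (signed_kact f).
Proof. by move=> Df; apply: (semi_domZ inL20_semi_inner); exact: kact_inL20. Qed.

Lemma signed_sym f g : inL20 pi f -> inL20 pi g ->
  l2dot pi (signed_kact f) g = l2dot pi f (signed_kact g).
Proof.
have SI := inL20_semi_inner.
move=> Df Dg; have Kf := kact_inL20 Df; have Kg := kact_inL20 Dg.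
rewrite [RHS](semi_sym SI) ?(semiZl SI)//; last exact: signed_dom.
congr (_ * _); rewrite [RHS](semi_sym SI)//.
by apply: kact_sym => //; [case/inL20P: Df|case/inL20P: Dg].
Qed.

Lemma signed_sqr f : inL20 pi f -> l2dot pi (e *: f) (e *: f) = l2dot pi f f.
Proof.
have SI := inL20_semi_inner.
move=> Df; have Def := semi_domZ SI e Df.
by rewrite (semiZl SI)// (semi_sym SI)// (semiZl SI)// mulrA ee mul1r.
Qed.

Lemma signed_contraction f : inL20 pi f ->
  l2dot pi (signed_kact f) (signed_kact f) <= l2dot pi f f.
Proof.
move=> Df; rewrite signed_sqr; last exact: kact_inL20.
by apply: kact_contraction => //; case/inL20P: Df.
Qed.

(** [e l - e K = e (l - K)], and squaring removes both [e] and the difference of sign from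
    [K - l]. *)
Lemma signed_shift_sqr l f : inL20 pi f ->
  (l2dot pi (shiftop signed_kact (e * l) f) (shiftop signed_kact (e * l) f))%:E =
  L2sq pi (fun x => kact K f x - l * f x).
Proof.
have SI := inL20_semi_inner.
move=> Df; have Kf := kact_inL20 Df.
have Ds : inL20 pi (l *: f - kact K f).
  by apply: (semi_domB SI) => //; exact: (semi_domZ SI).
have -> : shiftop signed_kact (e * l) f = e *: (l *: f - kact K f).
  by rewrite scalerBr scalerA.
rewrite signed_sqr// l2dotE; last by case/inL20P: Ds.
by apply: eq_integral => x _; congr EFin; rewrite -sqrrN opprB.
Qed.

Lemma signed_resolvent_bounded_below l : resolvent0 K pi (e * l) ->
  @bounded_below R _ (inL20 pi) (l2dot pi) signed_kact l.
Proof.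
move=> [[C hC] _]; exists C => f Df.
have := hC _ Df; rewrite -signed_shift_sqr// mulrA ee mul1r -EFinM.
rewrite /L2sq -l2dotE; last by case/inL20P: Df.
by rewrite lee_fin.
Qed.

(** The form bound makes [e l - e K] coercive with constant [e l - M], which yields both halves of
    the resolvent condition. *)
Lemma signed_coercive_resolvent l M : M < e * l ->
  (forall f, inL20 pi f -> l2dot pi (signed_kact f) f <= M * l2dot pi f f) ->
  resolvent0 K pi l.
Proof.
move=> Ml fM; have SI := inL20_semi_inner; have c0 : 0 < e * l - M by rewrite subr_gt0.
have coer f : inL20 pi f ->
    (e * l - M) * l2dot pi f f <= l2dot pi (shiftop signed_kact (e * l) f) f.
  move=> Df; rewrite (shiftopE SI signed_dom)// mulrBl lerD2l lerN2; exact: fM.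
split.
  exists ((e * l - M) ^+ 2)^-1 => f Df; rewrite -signed_shift_sqr//.
  rewrite /L2sq -l2dotE; last by case/inL20P: Df.
  by rewrite -EFinM lee_fin; exact: (coercive_bounded_below SI signed_dom c0 coer).
(* [K f - l f = g] is equivalent to [e (l - K) f = - e g]. *)
move=> g Dg; have Dg' := semi_domZ SI (- e) Dg.
have [f Df fg] := coercive_onto SI signed_dom signed_sym signed_contraction
  inL20_complete c0 coer Dg'.
exists f; split=> //.
have Kf := kact_inL20 Df.
have /inL20P[sr _] : inL20 pi (shiftop signed_kact (e * l) f - - e *: g).
  by apply: (semi_domB SI) => //; exact: (shiftop_dom SI signed_dom).
apply: filterS (l2dot_eq0 sr fg) => x.
rewrite (_ : (_ - _) x = e * l * f x - e * kact K f x - - e * g x)// => H.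
have : e * (e * l * f x - e * kact K f x - - e * g x) = 0 by rewrite H mulr0.
rewrite (_ : _ * _ = (e * e) * (l * f x - kact K f x + g x)); last by ring.
by rewrite ee mul1r; lra.
Qed.

End signed_kernel.
End mean_zero.

(** * Comparison of energies and transfer of the gap *)

Section energy.
Context {d : measure_display} {T : measurableType d} {R : realType}.
Variable pi : probability T R.

Lemma kact_sqr_integral (K : R.-pker T ~> T) (f : T -> R) :
  kreversible K pi -> sqint pi f ->
  pi.-integrable setT (EFin \o kact K (fun x => f x ^+ 2)) /\
  \int[pi]_x kact K (fun x => f x ^+ 2) x = l2dot pi f f.
Proof.
move=> K_rev [mf sf]; have mf2 : measurable_fun setT (fun x => f x ^+ 2).
  exact: measurable_funX.
have f2 x : 0 <= f x ^+ 2 by exact: sqr_ge0.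
have iK := integrable_kernel_integral K_rev mf2 f2 sf.
have mK := measurable_kact K mf2.
split.
  apply: le_integrable iK => //; first exact/measurable_EFinP.
  move=> x _; rewrite /kact /=.
  by case: (\int[K x]_y _)%E => [r||]//=; rewrite normr0 leey.
rewrite /l2dot /Rintegral; under [in RHS]eq_integral do rewrite -expr2.
rewrite -(reversible_integral K_rev mf2 f2); congr fine; apply: ae_eq_integral => //.
- exact/measurable_EFinP.
- by have /integrableP[] := iK.
apply: filterS (integrable_ae measurableT iK) => x /(_ Logic.I) fin _.
by rewrite /kact fineK.
Qed.

(* Both sides are half the integrals of [(f x - e * f y)^2] against [pi(dx)
   K(x, dy)], up to the factor [a]. *)
Lemma energy_domination (K0 K1 : R.-pker T ~> T) (a e : R) (f : T -> R) :
  kreversible K0 pi -> kreversible K1 pi -> 0 <= a -> e * e = 1 ->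
  (forall x A, measurable A -> (a%:E * K0 x A <= K1 x A)%E) -> sqint pi f ->
  a * (l2dot pi f f - e * l2dot pi (kact K0 f) f) <=
  l2dot pi f f - e * l2dot pi (kact K1 f) f.
Proof.
move=> rev0 rev1 a0 ee dom sf; have SI := sqint_semi_inner pi.
(* The expanded inner integral of [(f x - e * f y)^2] against [K x], valid where [f] is square
   integrable for [K x]; its terms can be integrated separately. *)
pose p (K : R.-pker T ~> T) x :=
  f x ^+ 2 - 2 * e * (kact K f x * f x) + kact K (fun x => f x ^+ 2) x.
have intE (K : R.-pker T ~> T) : kreversible K pi ->
    pi.-integrable setT (EFin \o p K) /\
    \int[pi]_x p K x = 2 * (l2dot pi f f - e * l2dot pi (kact K f) f).
  move=> rev; have [iK KE] := kact_sqr_integral rev sf.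
  have iKf := integrable_mul (kact_sqint rev sf) sf.
  have iKf2 := integrableZl measurableT (2 * e) iKf.
  have [_ if2] := sf.
  have i1 := integrableB measurableT if2 iKf2.
  split; first exact: (integrableD measurableT i1 iK).
  rewrite /p RintegralD// RintegralB// RintegralZl// KE.
  rewrite (_ : \int[pi]_x (f x ^+ 2) = l2dot pi f f); last first.
    by apply: eq_Rintegral => x _; rewrite expr2.
  by rewrite -/(l2dot pi (kact K f) f); ring.
have pE (K : R.-pker T ~> T) x : sqint (K x) f ->
    \int[K x]_y ((f x - e * f y) ^+ 2) = p K x.
  move=> sKf; rewrite (Rintegral_sqrB (prob_kernel x))// expr2 [e ^+ 2]expr2 ee.
  by rewrite /p /kact -!/(Rintegral _ _ _); ring.
have sq (K : R.-pker T ~> T) x : sqint (K x) f -> sqint (K x) (fun y => f x - e * f y).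
  move=> sKf; have SIx := sqint_semi_inner (K x).
  exact: (semi_domB SIx (sqint_cst (prob_kernel x) (f x)) (semi_domZ SIx e sKf)).
have [i0 E0] := intE _ rev0; have [i1 E1] := intE _ rev1.
suff : 0 <= \int[pi]_x (p K1 x - a * p K0 x).
  have ia := integrableZl measurableT a i0.
  by rewrite RintegralB// RintegralZl// E0 E1; lra.
apply: ae_Rintegral_ge0.
  exact: (integrableB measurableT i1 (integrableZl measurableT a i0)).
apply: filterS2 (ae_sqint_kernel rev0 sf) (ae_sqint_kernel rev1 sf) => x s0 s1.
rewrite subr_ge0 -(pE _ _ s0) -(pE _ _ s1).
have [m0 j0] := sq _ _ s0; have [m1 j1] := sq _ _ s1.
rewrite -lee_fin EFinM /Rintegral !fineK; last 2 first.
- exact: integrable_fin_num j1.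
- exact: integrable_fin_num j0.
(* The factor [a] is absorbed into the measure, so that [a * K0 x <= K1 x] applies to the
   nonnegative integrand. *)
rewrite -[a]/((NngNum a0)%:num) -ge0_integral_mscale//; first last.
- by move=> y _; rewrite lee_fin sqr_ge0.
- exact/measurable_EFinP/measurable_funX.
apply: ge0_le_measure_integral => //.
- by move=> A mA; exact: dom.
- by move=> y; rewrite lee_fin sqr_ge0.
- exact/measurable_EFinP/measurable_funX.
Qed.

(** The strict bound at each spectral point of [K0] already gives a uniform gap, because the
    supremum of the numerical range is itself a spectral point. The gap [1 - M] then shrinks by the
    factor [a]. *)
Lemma gap_transfer (K0 K1 : R.-pker T ~> T) (a e : R) :
  kreversible K0 pi -> kreversible K1 pi -> 0 < a -> e * e = 1 ->
  (forall x A, measurable A -> (a%:E * K0 x A <= K1 x A)%E) ->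
  (forall l, spectrum0 K0 pi l -> e * l < 1) ->
  exists2 M, M < 1 & forall l, spectrum0 K1 pi l -> e * l <= M.
Proof.
move=> rev0 rev1 a0 ee dom spec; have SI := inL20_semi_inner pi.
have [|M M1 hM] := range_lt1 SI (signed_dom rev0 e) (signed_sym rev0 e)
  (signed_contraction rev0 ee).
  move=> l lb; have := spec (e * l); rewrite mulrA ee mul1r; apply.
  by move=> res; apply: lb; exact: signed_resolvent_bounded_below.
exists (1 - a * (1 - M)); first by rewrite ltrBlDr ltrDl mulr_gt0// subr_gt0.
move=> l sl; rewrite leNgt; apply/negP => Ml; apply: sl.
apply: (signed_coercive_resolvent rev1 ee Ml) => f Df.
have /inL20P[sf _] := Df.
have H := energy_domination rev0 rev1 (ltW a0) ee dom sf.
have sSI := sqint_semi_inner pi.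
have := hM _ Df; rewrite /signed_kact !(semiZl sSI)//; try exact: kact_sqint.
have := semi_ge0 SI Df.
move: H; set q := l2dot _ f f; set u := l2dot _ _ _; set v := l2dot _ _ _ => H q0 H1.
have := ler_wpM2l (ltW a0) H1.
by lra.
Qed.

End energy.

(** * Countable mixtures of kernels *)

Section mixture.
Context {d : measure_display} {T : measurableType d} {R : realType}.
Variables (pi : probability T R) (K : nat -> R.-pker T ~> T) (a : nat -> R).
Variable Kt : R.-pker T ~> T.
Hypothesis a_ge0 : forall i, 0 <= a i.
Hypothesis KtE : forall x (A : set T), measurable A ->
  Kt x A = (\sum_(0 <= i <oo) (a i)%:E * K i x A)%E.

Lemma mixture_reversible : (forall i, kreversible (K i) pi) -> kreversible Kt pi.
Proof.
have E A B : measurable A -> measurable B ->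
    (\int[pi]_(x in A) Kt x B = \sum_(0 <= i <oo) (a i)%:E * \int[pi]_(x in A) K i x B)%E.
  move=> mA mB.
  have mK i : measurable_fun A (fun x => K i x B).
    by apply: (measurable_funS measurableT) => //; exact: measurable_kernel.
  under eq_integral do rewrite KtE//.
  rewrite integral_nneseries//.
  - by apply: eq_eseriesr => i _; rewrite ge0_integralZl// lee_fin.
  - by move=> i; exact: measurable_funeM.
  - by move=> i x _; rewrite mule_ge0// lee_fin.
by move=> rev A B mA mB; rewrite !E//; apply: eq_eseriesr => i _; rewrite rev.
Qed.

Lemma mixture_dominates x (A : set T) : measurable A ->
  ((a 0%N)%:E * K 0%N x A <= Kt x A)%E.
Proof.
move=> mA; rewrite KtE//.
have := @nneseries_lim_ge R (fun i => (a i)%:E * K i x A)%E xpredT 0 1.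
rewrite big_nat1; apply => i _ _; by rewrite mule_ge0// lee_fin.
Qed.

End mixture.

Unset Implicit Arguments.

(* Indices are shifted: the paper's K_1, a_1 are K 0%N, a 0%N here. *)
Theorem theorem5 (d : measure_display) (T : measurableType d) (R : realType)
  (pi : probability T R) (K : nat -> R.-pker T ~> T) (a : nat -> R)
  (Kt : R.-pker T ~> T) :
  (forall i, kreversible (K i) pi) ->
  (forall i, 0 <= a i) ->
  (\sum_(0 <= i <oo) (a i)%:E)%E = 1%E ->
  (forall x (A : set T), measurable A ->
     Kt x A = (\sum_(0 <= i <oo) (a i)%:E * K i x A)%E) ->
  0 < a 0%N ->
  invariant_distr (K 0%N) pi ->
  (forall mu : probability T R, invariant_distr (K 0%N) mu ->
     forall A : set T, measurable A -> mu A = pi A) ->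
  (variance_bounding (K 0%N) pi -> variance_bounding Kt pi) /\
  (geometrically_ergodic (K 0%N) pi -> geometrically_ergodic Kt pi).
Proof.
move=> rev a_ge0 _ KtE a0 _ _.
have revt := mixture_reversible a_ge0 KtE rev.
have dom := mixture_dominates a_ge0 KtE.
have transfer e := @gap_transfer _ _ _ pi (K 0%N) Kt (a 0%N) e (rev 0%N) revt a0 ^~ dom.
split=> [vb|ge].
  have [||M M1 hM] := transfer 1; first by rewrite mulr1.
    move=> l sl; rewrite mul1r -lte_fin; apply: le_lt_trans vb.
    by apply: ereal_sup_ubound; exists l.
  apply: (@le_lt_trans _ _ M%:E); last by rewrite lte_fin.
  by apply: ge_ereal_sup => _ [l sl <-]; rewrite lee_fin -[l]mul1r hM.
have abs1 l : spectrum0 (K 0%N) pi l -> `|l| < 1.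
  move=> sl; rewrite -lte_fin; apply: le_lt_trans ge.
  by apply: ereal_sup_ubound; exists l.
(* The two signs enclose the spectrum of [Kt] between [-N] and [M]. *)
have [||M M1 hM] := transfer 1; first by rewrite mulr1.
  by move=> l sl; rewrite mul1r (le_lt_trans (ler_norm _) (abs1 _ sl)).
have [||N N1 hN] := transfer (-1); first by rewrite mulN1r opprK.
  by move=> l sl; rewrite mulN1r (le_lt_trans _ (abs1 _ sl))// -normrN ler_norm.
apply: (@le_lt_trans _ _ (Num.max M N)%:E); last by rewrite lte_fin gt_max M1.
apply: ge_ereal_sup => _ [l sl <-]; rewrite lee_fin ler_norml lerNl le_max.
by have := hM _ sl; have := hN _ sl; rewrite mul1r mulN1r le_max => -> ->; rewrite orbT.
Qed.
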